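(* Let $d=3$, $n=1$, $G_H=\begin{pmatrix} 1 & 1 \\ 1 & -1 \end{pmatrix}$ over $\mathbb Z_3$, and for $0\le p\le1$ let $|\psi_p\rangle=\sqrt p\,|0\rangle+\sqrt{1-p}\,|1\rangle\in\mathbb C^3$, $\sigma_p=|\psi_p\rangle\langle\psi_p|$, and let $\Lambda_{\sigma_p}$ be the quantum convolutional channel with convolution matrix $G_H$ and environment $\sigma_p$. Define $$\rho_0=\tfrac34|0\rangle\langle0|+\tfrac14|1\rangle\langle1|+\tfrac14|0\rangle\langle1|+\tfrac14|1\rangle\langle0|,\qquad R|j\rangle=|1-j\rangle\ (j\in\mathbb Z_3),\qquad\rho_1=R\rho_0R^\dagger,$$ and $\boldsymbol\lambda(p)=(\lambda_0(p),\lambda_+(p),\lambda_-(p))$ with $$\lambda_0(p)=\frac{3-2p}{4},\qquad\lambda_\pm(p)=\frac{1+2p\pm\sqrt{12p^2-4p+1}}{8}.$$ Then: 1. $I_c(\rho_0,\Lambda_{\sigma_p})=H(\boldsymbol\lambda(p))-H(\boldsymbol\lambda(1-p))$ and $I_c(\rho_1,\Lambda_{\sigma_p})=-I_c(\rho_0,\Lambda_{\sigma_p})$. 2. $I_c(\rho_0,\Lambda_{\sigma_p})$ is $>0$ for $0<p<\frac12$, $=0$ for $p\in\{0,\frac12,1\}$, and $<0$ for $\frac12<p<1$. 3. Consequently $I_c^{\rm lb}(p):=\max\{I_c(\rho_0,\Lambda_{\sigma_p}),I_c(\rho_1,\Lambda_{\sigma_p})\}=|I_c(\rho_0,\Lambda_{\sigma_p})|$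 is positive for every $p\in(0,1)\setminus\{1/2\}$. 4. At $p=1/2$, $\Lambda^c_{\sigma_{1/2}}(\rho)=X\Lambda_{\sigma_{1/2}}(\rho)X^\dagger$ for every input $\rho$, where $X|j\rangle=|j+1\rangle$; hence $\Lambda_{\sigma_{1/2}}$ is unitarily self-complementary and $Q(\Lambda_{\sigma_{1/2}})=0$. 5. At $p=0$ and $p=1$ the channel $\Lambda_{\sigma_p}$ is entanglement breaking, and its quantum capacity vanishes.
   Context: All logarithms are base two. $S$ is the von Neumann entropy and $H$ the Shannon entropy of a probability vector. Basis labels are in $\mathbb Z_3$ (arithmetic mod $3$). Convolutional channel. For $G=\begin{pmatrix} g_{00} & g_{01} \\ g_{10} & g_{11} \end{pmatrix}$ invertible over $\mathbb Z_3$ and $N_G=(\det G)^{-1}$, $U_G$ is the unitary on $\mathbb C^3_A\otimes\mathbb C^3_B$ with $U_G|i,j\rangle=|N_Gg_{11}i-N_Gg_{10}j,\,-N_Gg_{01}i+N_Gg_{00}j\rangle$, $i,j\in\mathbb Z_3$, and $\Lambda_\sigma(\rho)=\operatorname{tr}_B[U_G(\rho\otimes\sigma)U_G^\dagger]$. For a pure environment $\sigma$, the complementary channel is $\Lambda_\sigma^c(\rho)=\operatorname{tr}_A[U_G(\rho\otimes\sigma)U_G^\dagger]$. The coherent information is $I_c(\rho,\Lambda)=S(\Lambda(\rho))-S(\Lambda^c(\rho))$, and $Q(\Lambda)$ denotes the quantum capacity, $Q(\Lambda)=\lim_{m\to\infty}\frac1m\max_\rho I_c(\rho,\Lambda^{\otimes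 m})$. A channel $\Lambda$ is entanglement breaking if $(\mathrm{id}\otimes\Lambda)(\omega)$ is separable for every bipartite state $\omega$. *)

(* Defs.v *)
From mathcomp Require Export all_boot all_order all_algebra.
From mathcomp Require Export spectral complex mxtens.
From mathcomp Require Export boolp classical_sets reals topology normedtype
  sequences exp.

Set Implicit Arguments.
Unset Strict Implicit.
Unset Printing Implicit Defensive.

Export Order.TTheory GRing.Theory Num.Theory.
Export numFieldNormedType.Exports.

#[global] Open Scope classical_set_scope.
#[global] Open Scope complex_scope.
#[global] Open Scope sesquilinear_scope.
#[global] Open Scope ring_scope.

Section Quantum.
Context {R : realType}.
Local Notation C := R[i].

Definition psdmx n (A : 'M[C]_n) : Prop :=
  A^t* = A /\ forall v : 'cV[C]_n, 0 <= (v^t* *m A *m v) 0 0.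

Definition density n (rho : 'M[C]_n) : Prop := psdmx rho /\ \tr rho = 1.

Definition log2 (x : R) : R := ln x / ln 2.

(* Since [ln 0 = 0], zero entries contribute 0. *)
Definition shannon n (v : 'rV[R]_n) : R :=
  - \sum_(i < n) v 0 i * log2 (v 0 i).

(* Functional calculus: if [A = U^t* D U] is the spectral decomposition of the
   Hermitian matrix [A], this is [U^t* f(D) U]. *)
Definition fun_hermmx n (f : R -> R) (A : 'M[C]_n) : 'M[C]_n :=
  (spectralmx A)^t*
    *m diag_mx (map_mx (fun z => (f (complex.Re z))%:C) (spectral_diag A))
    *m spectralmx A.

Definition vonNeumann n (rho : 'M[C]_n) : R :=
  - complex.Re (\tr (rho *m fun_hermmx log2 rho)).

Definition ptrace2 a b (X : 'M[C]_(a * b)) : 'M[C]_a :=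
  \matrix_(i, j) \sum_(k < b) X (mxtens_index (i, k)) (mxtens_index (j, k)).

Definition ptrace1 a b (X : 'M[C]_(a * b)) : 'M[C]_b :=
  \matrix_(k, l) \sum_(i < a) X (mxtens_index (i, k)) (mxtens_index (i, l)).

(* For linear [Phi] and [Psi], the linear map determined by
   [A (x) B |-> Phi A (x) Psi B], expanded on matrix units. *)
Definition tens_map a b c d (Phi : 'M[C]_a -> 'M[C]_b)
    (Psi : 'M[C]_c -> 'M[C]_d) (X : 'M[C]_(a * c)) : 'M[C]_(b * d) :=
  \sum_(i < a) \sum_(j < a) \sum_(k < c) \sum_(l < c)
    X (mxtens_index (i, k)) (mxtens_index (j, l))
      *: tensmx (Phi (delta_mx i j)) (Psi (delta_mx k l)).

(* [d ^ m], by a recursion that makes the type of [tens_pow] below definitional. *)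
Fixpoint powdim (d m : nat) : nat :=
  if m is m'.+1 then (d * powdim d m')%N else 1%N.

Fixpoint tens_pow a b (Phi : 'M[C]_a -> 'M[C]_b) (m : nat) :
    'M[C]_(powdim a m) -> 'M[C]_(powdim b m) :=
  match m return 'M[C]_(powdim a m) -> 'M[C]_(powdim b m) with
  | 0%N => fun X => X
  | m'.+1 => tens_map Phi (@tens_pow a b Phi m')
  end.
Arguments tens_pow {a b} Phi m X.

(* A channel enters coherent information together with its complementary
   channel. *)
Definition coherent_info a b e (Phi : 'M[C]_a -> 'M[C]_b)
    (Phic : 'M[C]_a -> 'M[C]_e) (rho : 'M[C]_a) : R :=
  vonNeumann (Phi rho) - vonNeumann (Phic rho).

(* [q = lim_m (1/m) max_rho I_c(rho, Phi^(x)m)]; both the existence of the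
   maxima and that of the limit are asserted.  The complementary channel of
   [Phi^(x)m] is [Phic^(x)m]. *)
Definition is_quantum_capacity a b e (Phi : 'M[C]_a -> 'M[C]_b)
    (Phic : 'M[C]_a -> 'M[C]_e) (q : R) : Prop :=
  exists M : nat -> R,
    (forall m : nat, (0 < m)%N ->
       let vals := [set coherent_info (tens_pow Phi m) (tens_pow Phic m) rho
                   | rho in [set rho | density rho]] in
       vals (M m) /\ ubound vals (M m))
    /\ ((fun m : nat => M m / m%:R) @ \oo --> q).

Definition separable a b (X : 'M[C]_(a * b)) : Prop :=
  exists (n : nat) (w : 'I_n -> R) (al : 'I_n -> 'M[C]_a) (be : 'I_n -> 'M[C]_b),
    [/\ forall i, 0 <= w i,
        \sum_i w i = 1,
        forall i, density (al i) /\ density (be i)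
      & X = \sum_i (w i)%:C *: tensmx (al i) (be i)].

Definition entanglement_breaking a b (Phi : 'M[C]_a -> 'M[C]_b) : Prop :=
  forall (k : nat) (omega : 'M[C]_(k * a)),
    density omega -> separable (tens_map (fun A : 'M[C]_k => A) Phi omega).

Definition unitarily_self_complementary a b (Phi Phic : 'M[C]_a -> 'M[C]_b) :
    Prop :=
  exists2 V : 'M[C]_b, V \is unitarymx &
    forall rho, Phic rho = V *m Phi rho *m V^t*.

Definition ket (j : 'Z_3) : 'cV[C]_3 := delta_mx j 0.
Definition ketbra (i j : 'Z_3) : 'M[C]_3 := ket i *m (ket j)^t*.

(* The operator [|j> |-> |f j>]. *)
Definition label_op (f : 'Z_3 -> 'Z_3) : 'M[C]_3 := \sum_(j : 'Z_3) ketbra (f j) j.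

Definition conv_label (G : 'M['Z_3]_2) (ij : 'Z_3 * 'Z_3) : 'Z_3 * 'Z_3 :=
  let N := (\det G)^-1 in
  (N * G 1 1 * ij.1 - N * G 1 0 * ij.2, - N * G 0 1 * ij.1 + N * G 0 0 * ij.2).

Definition conv_unitary (G : 'M['Z_3]_2) : 'M[C]_(3 * 3) :=
  \sum_(i : 'Z_3) \sum_(j : 'Z_3)
    tensmx (ketbra (conv_label G (i, j)).1 i) (ketbra (conv_label G (i, j)).2 j).

Definition conv_channel (G : 'M['Z_3]_2) (sigma rho : 'M[C]_3) : 'M[C]_3 :=
  ptrace2 (conv_unitary G *m tensmx rho sigma *m (conv_unitary G)^t*).

Definition conv_channel_compl (G : 'M['Z_3]_2) (sigma rho : 'M[C]_3) : 'M[C]_3 :=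
  ptrace1 (conv_unitary G *m tensmx rho sigma *m (conv_unitary G)^t*).

Definition G_H : 'M['Z_3]_2 :=
  \matrix_(i, j) if (i == 1) && (j == 1) then -1 else 1.

Definition psi (p : R) : 'cV[C]_3 :=
  (Num.sqrt p)%:C *: ket 0 + (Num.sqrt (1 - p))%:C *: ket 1.

Definition sigma (p : R) : 'M[C]_3 := psi p *m (psi p)^t*.

Definition Lambda (p : R) : 'M[C]_3 -> 'M[C]_3 := conv_channel G_H (sigma p).
Definition Lambdac (p : R) : 'M[C]_3 -> 'M[C]_3 :=
  conv_channel_compl G_H (sigma p).

Definition rho0 : 'M[C]_3 :=
  (3 / 4) *: ketbra 0 0 + (1 / 4) *: ketbra 1 1
  + (1 / 4) *: ketbra 0 1 + (1 / 4) *: ketbra 1 0.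

Definition Rop : 'M[C]_3 := label_op (fun j => 1 - j).
Definition Xop : 'M[C]_3 := label_op (fun j => j + 1).

Definition rho1 : 'M[C]_3 := Rop *m rho0 *m Rop^t*.

Definition lam0 (p : R) : R := (3 - 2 * p) / 4.
Definition lamp (p : R) : R :=
  (1 + 2 * p + Num.sqrt (12 * p ^+ 2 - 4 * p + 1)) / 8.
Definition lamm (p : R) : R :=
  (1 + 2 * p - Num.sqrt (12 * p ^+ 2 - 4 * p + 1)) / 8.
Definition lam (p : R) : 'rV[R]_3 :=
  \row_i [:: lam0 p; lamp p; lamm p]`_i.

Definition Ic0 (p : R) : R := coherent_info (Lambda p) (Lambdac p) rho0.
Definition Ic1 (p : R) : R := coherent_info (Lambda p) (Lambdac p) rho1.

Definition Ic_lb (p : R) : R := Num.max (Ic0 p) (Ic1 p).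

End Quantum.

Arguments tens_pow {R a b} Phi m X.

(* Main.v *)
Require Import Defs.
From mathcomp Require Import derive realfun ring lra.

Set Implicit Arguments.
Unset Strict Implicit.
Unset Printing Implicit Defensive.

(* Over Z_3 the convolution with matrix G_H is
     Lambda_sigma(rho)_(a,a') = sum_b rho_(a+b,a'+b) sigma_(a-b,a'-b),
   and reversing the labels 0 and 1 of the environment swaps p and 1 - p. Hence
   Lambdac_p = X Lambda_(1-p) X^*, and all coherent informations reduce to the
   entropy of Lambda_p(rho0), whose spectrum is lambda(p). The same relation
   between the two outputs makes every tensor power have zero coherent
   information at p = 1/2, and likewise at p = 0, 1, where the channel measures in
   the label basis and prepares a label state.

   For the sign, lambda_+ lambda_- = p(1-p)/8 is symmetric in p and 1 - p and
   lambda_+(p) + lambda_-(p) = lambda_0(1-p). Writing lambda_+- = r exp(+-s) with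
   r = sqrt(p(1-p)/8), the entropy difference is a difference of values of
     s |-> 2 cosh s ln(2 cosh s) - 2 s sinh s,
   which decreases strictly on s >= 0 because ln(2 cosh s) < s coth s. *)

(** * Entropy along a hyperbola of constant product *)

Section EntropyOnHyperbola.
Context {R : realType}.

Definition cosh_entropy (s : R) : R :=
  (expR s + expR (- s)) * ln (expR s + expR (- s)) - s * (expR s - expR (- s)).

Lemma is_derive_cosh_entropy (s : R) : is_derive s 1 cosh_entropy
  ((expR s - expR (- s)) * ln (expR s + expR (- s)) - s * (expR s + expR (- s))).
Proof.
have c_gt0 : 0 < expR s + expR (- s) by rewrite addr_gt0 ?expR_gt0.
have dN : is_derive s 1 (fun x : R => expR (- x)) (- expR (- s)).
  by apply: is_derive_eq; rewrite mulrN1.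
have dln : is_derive s 1 (fun x : R => ln (expR x + expR (- x)))
    ((expR s + expR (- s))^-1 * (expR s - expR (- s))).
  have dg : is_derive s 1 (fun x : R => expR x + expR (- x)) (expR s - expR (- s)).
    exact: is_deriveD.
  pose g (x : R) := expR x + expR (- x).
  have dl : is_derive (g s) 1 (@ln R) (expR s + expR (- s))^-1 by exact: is_derive1_ln.
  exact: (@is_derive1_comp _ _ g s _ _ dl dg).
rewrite /cosh_entropy; apply: is_derive_eq; rewrite /= !scaler1.
rewrite /GRing.scale /=; field; exact: lt0r_neq0.
Qed.

(** Put [a = expR s] and [b = expR (- s)], so [a * b = 1]. Then [ln (a + b) = s + ln (1 + b ^+ 2) <=
    s + b ^+ 2]; after multiplication by [a - b > 0] the claim reduces to [1 - 2 * s < b ^+ 2], the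
    tangent bound for the exponential at [- 2 * s]. *)
Lemma cosh_entropy_derive_lt0 (s : R) : 0 < s ->
  (expR s - expR (- s)) * ln (expR s + expR (- s)) - s * (expR s + expR (- s)) < 0.
Proof.
move=> s_gt0.
have a_gt0 := expR_gt0 s; have b_gt0 := expR_gt0 (- s).
have ab : expR s * expR (- s) = 1 by rewrite expRN mulfV ?gt_eqF.
have lnE : ln (expR s + expR (- s)) <= s + expR (- s) ^+ 2.
  have -> : expR s + expR (- s) = expR s * (1 + expR (- s) ^+ 2) by ring: ab.
  rewrite lnM ?posrE ?addr_gt0 ?exprn_gt0 // expRK lerD2l.
  by apply: le_ln1Dx; rewrite (lt_trans _ (exprn_gt0 _ _)) ?ltrN10.
have b2 : 1 - 2 * s < expR (- s) ^+ 2.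
  by rewrite -expRM_natl mulrN; apply: expR_gt1Dx; rewrite oppr_eq0 mulf_neq0 ?gt_eqF.
have ba : 0 < expR s - expR (- s).
  by rewrite subr_gt0 ltr_expR; lra.
have := ler_wpM2l (ltW ba) lnE.
have : expR (- s) * (1 - 2 * s) < expR (- s) * expR (- s) ^+ 2 by rewrite ltr_pM2l.
have : (expR s - expR (- s)) * (s + expR (- s) ^+ 2) =
  s * (expR s + expR (- s)) - 2 * s * expR (- s) + expR (- s) - expR (- s) ^+ 3.
  by ring: ab.
rewrite (_ : expR (- s) * expR (- s) ^+ 2 = expR (- s) ^+ 3); last by ring.
lra.
Qed.

Lemma cosh_entropy_decr (s t : R) : 0 <= s -> s < t -> cosh_entropy t < cosh_entropy s.
Proof.
move=> s_ge0 st.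
have dh (x : R) : derivable cosh_entropy x 1 by case: (is_derive_cosh_entropy x).
(* The derivative vanishes at 0, so strict negativity is used only in the open interval from 0 to
   [t]. *)
apply: (@ltr0_derive1_decr _ _ 0 t) => //.
- move=> x /itvP x0t; rewrite derive1E.
  rewrite (@derive_val _ _ _ _ _ _ _ (is_derive_cosh_entropy x)).
  by apply: cosh_entropy_derive_lt0; rewrite x0t.
- apply: continuous_subspaceT => x; apply: differentiable_continuous.
  exact/derivable1_diffP.
Qed.

Definition negxlnx (x : R) : R := - (x * ln x).

(** With [s = ln (x / r)] one has [x = r * expR s] and [y = r * expR (- s)]. The [ln r] terms cancel
    because [x + y] is subtracted with its own logarithm. *)
Lemma entropy_hyperbola (x y : R) : 0 < x -> 0 < y ->
  let r := Num.sqrt (x * y) in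
  negxlnx x + negxlnx y - negxlnx (x + y) = r * cosh_entropy (ln (x / r)).
Proof.
move=> x_gt0 y_gt0 r.
have r_gt0 : 0 < r by rewrite sqrtr_gt0 mulr_gt0.
have r_neq0 : r != 0 by rewrite gt_eqF.
have r2 : r * r = x * y by rewrite -expr2 sqr_sqrtr // ltW // mulr_gt0.
have es : expR (ln (x / r)) = x / r by rewrite lnK // posrE divr_gt0.
have eNs : expR (- ln (x / r)) = y / r.
  rewrite expRN es invf_div; apply: (canRL (mulfK r_neq0)).
  by rewrite mulrAC r2 mulrC mulKf ?gt_eqF.
rewrite /cosh_entropy /negxlnx es eNs -mulrDl !ln_div ?posrE ?addr_gt0 //.
have -> : ln y = ln r + ln r - ln x.
  by rewrite -lnM ?posrE // r2 lnM ?posrE // addrC addKr.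
by field.
Qed.

(** Equal products give both points the same [r]; the parameter [ln (x / r)] is nonnegative since
    [r <= x], and it grows with [x]. *)
Lemma entropy_hyperbola_lt (x y x' y' : R) : 0 < y -> y <= x -> x < x' -> x * y = x' * y' ->
  negxlnx x' + negxlnx y' - negxlnx (x' + y') < negxlnx x + negxlnx y - negxlnx (x + y).
Proof.
move=> y_gt0 yx xx' xy.
have x_gt0 := lt_le_trans y_gt0 yx; have x'_gt0 := lt_trans x_gt0 xx'.
have y'_gt0 : 0 < y' by rewrite -(pmulr_rgt0 _ x'_gt0) -xy mulr_gt0.
rewrite !entropy_hyperbola // -xy; set r := Num.sqrt (x * y).
have r_gt0 : 0 < r by rewrite sqrtr_gt0 mulr_gt0.
rewrite ltr_pM2l //; apply: cosh_entropy_decr.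
  rewrite ln_ge0 // ler_pdivlMr // mul1r -[leRHS](ger0_norm (ltW x_gt0)) -sqrtr_sqr.
  by rewrite ler_sqrt ?exprn_ge0 ?(ltW x_gt0) // expr2 ler_pM2l.
by rewrite ltr_ln ?posrE ?divr_gt0 // ltr_pM2r ?invr_gt0.
Qed.

Lemma shannon_lam_lt (p : R) : 0 < p -> p < 2^-1 ->
  shannon (lam (1 - p)) < shannon (lam p).
Proof.
move=> p_gt0 p_lt.
have ln2 : 0 < ln (2 : R) by rewrite ln_gt0 // ltr1n.
have shE (q : R) : shannon (lam q) =
    (negxlnx (lam0 q) + negxlnx (lamp q) + negxlnx (lamm q)) / ln 2.
  rewrite /shannon !big_ord_recl big_ord0 /log2 /negxlnx !mxE /=.
  field; exact: lt0r_neq0.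
have sumE (q : R) : lamp q + lamm q = lam0 (1 - q) by rewrite /lamp /lamm /lam0; lra.
(* This quadratic has discriminant -32, so it has no real root. *)
have disc (q : R) : 0 < 12 * q ^+ 2 - 4 * q + 1 by nra.
have sq (q : R) := sqr_sqrtr (ltW (disc q)).
have prodE (q : R) : lamp q * lamm q = q * (1 - q) / 8.
  by rewrite /lamp /lamm; field: (sq q).
rewrite !shE ltr_pM2r ?invr_gt0 //.
(* By [sumE] the subtracted terms are those of [lam0 (1 - p)] and [lam0 p]. Moving each to the other
   side completes the two entropies. *)
have := @entropy_hyperbola_lt (lamp p) (lamm p) (lamp (1 - p)) (lamm (1 - p)).
rewrite !sumE !prodE subKr (mulrC p).
suff [lm_gt0 lm_le lp_lt] : [/\ 0 < lamm p, lamm p <= lamp p & lamp p < lamp (1 - p)].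
  by move=> /(_ lm_gt0 lm_le lp_lt erefl); lra.
have lm_le : lamm p <= lamp p.
  by have := sqrtr_ge0 (12 * p ^+ 2 - 4 * p + 1); rewrite /lamm /lamp; lra.
have lp_gt0 : 0 < lamp p.
  by have := sqrtr_ge0 (12 * p ^+ 2 - 4 * p + 1); rewrite /lamp; lra.
split=> //.
  by rewrite -(pmulr_rgt0 _ lp_gt0) prodE; nra.
(* The radicands differ by [8 * (1 - 2 * p)]. *)
have : Num.sqrt (12 * p ^+ 2 - 4 * p + 1) < Num.sqrt (12 * (1 - p) ^+ 2 - 4 * (1 - p) + 1).
  by rewrite ltr_sqrt //; nra.
by rewrite /lamp; lra.
Qed.

End EntropyOnHyperbola.

Section Quantum.
Context {R : realType}.
Local Notation C := R[i].

(** * Von Neumann entropy from the characteristic polynomial *)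

Lemma trmxC_mul m n p (A : 'M[C]_(m, n)) (B : 'M_(n, p)) :
  (A *m B)^t* = B^t* *m A^t*.
Proof. by rewrite trmx_mul map_mxM. Qed.

Lemma normal_hermitian n (A : 'M[C]_n) : A^t* = A -> A \is normalmx.
Proof. by move=> hA; apply/normalmxP; rewrite hA. Qed.

Lemma unitary_charpoly n (V A : 'M[C]_n) : V \is unitarymx ->
  char_poly (V *m A *m V^t*) = char_poly A.
Proof.
move=> /unitarymxP Vu; rewrite /char_poly.
have Vpu : map_mx polyC V *m map_mx polyC (V^t*) = 1%:M.
  by rewrite -map_mxM Vu map_mx1.
have -> : char_poly_mx (V *m A *m V^t*) =
    map_mx polyC V *m char_poly_mx A *m map_mx polyC (V^t*).
  rewrite /char_poly_mx mulmxBr mulmxBl !map_mxM.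
  by rewrite scalar_mxC -(mulmxA (_%:M)) Vpu mulmx1.
by rewrite !det_mulmx mulrAC -det_mulmx Vpu det1 mul1r.
Qed.

Lemma normal_charpoly n (A : 'M[C]_n) : A \is normalmx ->
  char_poly A = \prod_(i < n) ('X - (spectral_diag A 0 i)%:P).
Proof.
move=> /orthomx_spectralP A_eq.
have Vu := spectral_unitarymx A.
rewrite {1}A_eq invmx_unitary // -{2}[spectralmx A]trmxCK.
rewrite unitary_charpoly ?trmxC_unitary // char_poly_trig ?diag_mx_is_trig //.
by apply: eq_bigr => i _; rewrite mxE eqxx.
Qed.

Lemma vonNeumannE n (A : 'M[C]_n) : A \is normalmx ->
  vonNeumann A = - \sum_(i < n) complex.Re (spectral_diag A 0 i) *
                                log2 (complex.Re (spectral_diag A 0 i)).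
Proof.
move=> /orthomx_spectralP A_eq; rewrite /vonNeumann /fun_hermmx.
have Vu := spectral_unitarymx A.
rewrite {1}A_eq invmx_unitary // -!mulmxA [spectralmx A *m (_ *m _)]mulmxA.
have /unitarymxP -> := Vu; rewrite mul1mx mxtrace_mulC -!mulmxA.
have /unitarymxP -> := Vu; rewrite mulmx1 mulmx_diag mxtrace_diag raddf_sum.
congr (- _); apply: eq_bigr => i _; rewrite !mxE /=.
by case: (spectral_diag A 0 i) => x y /=; rewrite mulr0 subr0.
Qed.

(* [spectral_diag A] depends on a choice, but as a multiset it is determined by
   the characteristic polynomial. *)
Lemma vonNeumann_charpoly_seq n (A : 'M[C]_n) (s : seq C) : A \is normalmx ->
  char_poly A = \prod_(z <- s) ('X - z%:P) ->
  vonNeumann A = - \sum_(z <- s) complex.Re z * log2 (complex.Re z).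
Proof.
move=> nA; rewrite normal_charpoly //.
rewrite -(big_map (spectral_diag A 0) xpredT (fun z => 'X - z%:P)).
move=> /prod_XsubC_eq st; rewrite vonNeumannE //; congr (- _).
rewrite -(big_map (spectral_diag A 0) xpredT
  (fun z => complex.Re z * log2 (complex.Re z))).
exact: perm_big.
Qed.

Lemma vonNeumann_shannon n (A : 'M[C]_n) (v : 'rV[R]_n) : A^t* = A ->
  char_poly A = \prod_(i < n) ('X - ((v 0 i)%:C)%:P) ->
  vonNeumann A = shannon v.
Proof.
move=> /normal_hermitian nA.
rewrite -(big_map (fun i => (v 0 i)%:C) xpredT (fun z => 'X - z%:P)).
by move=> /(vonNeumann_charpoly_seq nA) ->; rewrite big_map.
Qed.

(** The two matrices may get unrelated spectral decompositions, but they share their characteristic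
    polynomial. *)
Lemma vonNeumann_unitary n (V A : 'M[C]_n) : V \is unitarymx -> A^t* = A ->
  vonNeumann (V *m A *m V^t*) = vonNeumann A.
Proof.
move=> Vu hA; have nA := normal_hermitian hA.
have nB : V *m A *m V^t* \is normalmx.
  by apply: normal_hermitian; rewrite !trmxC_mul trmxCK hA mulmxA.
have eAB : char_poly (V *m A *m V^t*) =
    \prod_(z <- [seq spectral_diag A 0 i | i <- enum 'I_n]) ('X - z%:P).
  by rewrite unitary_charpoly // normal_charpoly // big_map big_enum.
rewrite (vonNeumann_charpoly_seq nB eAB).
by rewrite big_map big_enum vonNeumannE.
Qed.

(** * Positive semidefinite matrices and separable states *)

Lemma psdmx_conj m n (E : 'M[C]_(m, n)) (A : 'M[C]_n) :
  psdmx A -> psdmx (E *m A *m E^t*).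
Proof.
move=> [hA pA]; split; first by rewrite !trmxC_mul trmxCK hA mulmxA.
move=> v; have := pA (E^t* *m v).
by rewrite trmxC_mul trmxCK !mulmxA.
Qed.

Lemma psdmx1 : psdmx (1%:M : 'M[C]_1).
Proof.
split=> [|v]; first by rewrite trmx1 map_mx1.
by rewrite mulmx1 mxE big_ord1 !mxE mulrC mul_conjC_ge0.
Qed.

Lemma density_delta n (i : 'I_n) : density (delta_mx i i : 'M[C]_n).
Proof.
split; last first.
  by rewrite /mxtrace (bigD1 i) //= big1 => [|j /negbTE ij];
    rewrite ?mxE ?eqxx ?addr0 // ij.
have -> : delta_mx i i =
    delta_mx i (0 : 'I_1) *m 1%:M *m (delta_mx i (0 : 'I_1))^t* :> 'M[C]_n.
  by rewrite mulmx1 trmx_delta map_delta_mx mul_delta_mx.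
exact/psdmx_conj/psdmx1.
Qed.

(** Reindexing is conjugation by a 0/1 matrix. It will be applied to the block of a bipartite state
    at a fixed label of the second factor. *)
Lemma psdmx_mxsub m n (f : 'I_m -> 'I_n) (A : 'M[C]_n) :
  psdmx A -> psdmx (mxsub f f A).
Proof.
move=> /(psdmx_conj (rowsub f 1%:M)).
suff -> : rowsub f 1%:M *m A *m (rowsub f 1%:M)^t* = mxsub f f A by [].
rewrite mul_rowsub_mx mul1mx trmx_mxsub map_mxsub trmx1 map_mx1.
by rewrite mulmx_colsub mulmx1; apply/matrixP=> i j; rewrite !mxE.
Qed.

Lemma psdmx_diag_ge0 n (A : 'M[C]_n) i : psdmx A -> 0 <= A i i.
Proof.
move=> [_ /(_ (delta_mx i 0))].
by rewrite trmx_delta map_delta_mx -mulmxA -colE -rowE !mxE.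
Qed.

Lemma psdmx_mxtrace_ge0 n (A : 'M[C]_n) : psdmx A -> 0 <= \tr A.
Proof. by move=> pA; apply: sumr_ge0 => i _; apply: psdmx_diag_ge0. Qed.

(** The eigenvalues are nonnegative and sum to zero. This disposes of the terms of weight zero in a
    separable decomposition. *)
Lemma psdmx_mxtrace0 n (A : 'M[C]_n) : psdmx A -> \tr A = 0 -> A = 0.
Proof.
move=> pA trA; have Uu := spectral_unitarymx A.
have /orthomx_spectralP : A \is normalmx by apply/normalmxP; case: pA => ->.
rewrite invmx_unitary // => A_eq.
have D_eq : spectralmx A *m A *m (spectralmx A)^t* = diag_mx (spectral_diag A).
  rewrite {2}A_eq !mulmxA; have /unitarymxP -> := Uu.
  by rewrite mul1mx -mulmxA; have /unitarymxP -> := Uu; rewrite mulmx1.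
have pD := psdmx_conj (spectralmx A) pA; rewrite D_eq in pD.
have trD : \tr (diag_mx (spectral_diag A)) = 0.
  by rewrite -D_eq mxtrace_mulC mulmxA (mulmx1C (unitarymxP Uu)) mul1mx.
have d0 : diag_mx (spectral_diag A) = 0.
  have /eqP := trD; rewrite psumr_eq0 => [/allP d0|i _]; last exact: psdmx_diag_ge0.
  apply/matrixP=> i j; rewrite !mxE; case: eqP => // _.
  by have /eqP := d0 i (mem_index_enum i); rewrite mxE eqxx.
by rewrite A_eq d0 mulmx0 mul0mx.
Qed.

(** The weights are the traces of the [A i], and normalization turns each nonzero [A i] into a
    state. *)
Lemma separable_sum n a b (A : 'I_n -> 'M[C]_a) (tau : 'I_n -> 'M[C]_b) :
  (forall i, psdmx (A i)) -> (forall i, density (tau i)) ->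
  \sum_i \tr (A i) = 1 -> separable (\sum_i tensmx (A i) (tau i)).
Proof.
move=> pA dtau trA.
have [w wE] : exists w : 'I_n -> R, forall i, \tr (A i) = (w i)%:C.
  exists (fun i => complex.Re (\tr (A i))) => i.
  by rewrite RRe_real // ger0_real // psdmx_mxtrace_ge0.
have w_ge0 i : 0 <= w i by rewrite -lecR -wE psdmx_mxtrace_ge0.
(* A filler state for the indices of weight zero; dimension [a = 0] would make the total trace 0
   instead of 1. *)
have [rho drho] : exists rho : 'M[C]_a, density rho.
  case: a A pA trA wE => [|a] A pA trA wE; last by exists (delta_mx 0 0); exact: density_delta.
  have /eqP : \sum_i \tr (A i) = 0 by apply: big1 => i _; rewrite /mxtrace big_ord0.
  by rewrite trA oner_eq0.
exists n, w, (fun i => if w i == 0 then rho else ((w i)^-1)%:C *: A i), tau; split => //.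
- by apply: (@complexI R); rewrite rmorph_sum rmorph1 -trA; apply: eq_bigr => i _; rewrite wE.
- move=> i; split=> //; case: eqP => // /eqP w0.
  split; last by rewrite mxtraceZ wE -rmorphM mulVf.
  have [hA qA] := pA i; split; first by rewrite linearZ map_mxZ /= hA [Num.conj _]conjc_real.
  move=> v; rewrite -scalemxAr -scalemxAl mxE mulr_ge0 //.
  by rewrite lecR invr_ge0.
apply: eq_bigr => i _; case: eqP => [w0|/eqP w0].
  by rewrite w0 scale0r (psdmx_mxtrace0 (pA i)) ?wE ?w0 // tens0mx.
by apply/matrixP=> k l; rewrite !mxE mulrA [in RHS]mulrA -rmorphM mulfV // mul1r.
Qed.

(** Measuring the second factor of [X] leaves, for each outcome [m], an unnormalized state of the
    first factor, namely a diagonal block of [X], next to the prepared [tau m]. The traces of these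
    blocks add up to [\tr X]. *)
Lemma measure_prepare_entanglement_breaking a b (tau : 'I_a -> 'M[C]_b)
    (Phi : 'M[C]_a -> 'M[C]_b) :
  (forall j, density (tau j)) -> (forall A : 'M_a, Phi A = \sum_j A j j *: tau j) ->
  entanglement_breaking Phi.
Proof.
move=> dtau PhiE k X [pX trX].
pose f (m : 'I_a) (x : 'I_k) := mxtens_index (x, m).
suff -> : tens_map (fun A : 'M_k => A) Phi X =
    \sum_m tensmx (mxsub (f m) (f m) X) (tau m).
  apply: separable_sum => // [m|]; first exact: psdmx_mxsub.
  rewrite -trX exchange_big /= pair_big [RHS](reindex (@mxtens_index k a)) /=; last first.
    by exists (@mxtens_unindex k a) => l _; rewrite (mxtens_indexK, mxtens_unindexK).
  by apply: eq_bigr => -[x m] _; rewrite mxE.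
(* At this entry the identity factor keeps only the matrix unit at [x], [x'], and [Phi] kills every
   off-diagonal matrix unit of the second factor. *)
apply/matrixP=> l l'; case: (mxtens_indexP l) => x y; case: (mxtens_indexP l') => x' y'.
rewrite /tens_map !summxE (bigD1 x) //= [X in _ + X]big1 ?addr0 => [|i ix]; last first.
  rewrite summxE big1 // => j _; rewrite summxE big1 // => m _.
  rewrite summxE big1 // => m' _.
  by rewrite mxE tensmxE mxE eq_sym (negbTE ix) mul0r mulr0.
rewrite summxE (bigD1 x') //= [X in _ + X]big1 ?addr0 => [|i ix]; last first.
  rewrite summxE big1 // => m _; rewrite summxE big1 // => m' _.
  by rewrite mxE tensmxE mxE [x' == _]eq_sym (negbTE ix) andbF mul0r mulr0.
rewrite summxE; apply: eq_bigr => m _; rewrite tensmxE mxE.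
rewrite summxE (bigD1 m) //= [X in _ + X]big1 ?addr0 => [|m' mm'];
  rewrite mxE tensmxE mxE !eqxx mul1r.
  rewrite PhiE (bigD1 m) //= big1 ?addr0 ?mxE ?eqxx ?mul1r // => j jm.
  by rewrite mxE (negbTE jm) scale0r.
rewrite PhiE big1 ?mxE ?mulr0 // => j _; rewrite mxE.
by case: (j =P m) => [->|_]; rewrite ?[m == _]eq_sym ?(negbTE mm') scale0r.
Qed.

(** * Tensor powers and vanishing capacity *)

Lemma tensmx_unitary m n (V : 'M[C]_m) (W : 'M[C]_n) :
  V \is unitarymx -> W \is unitarymx -> tensmx V W \is unitarymx.
Proof.
move=> /unitarymxP Vu /unitarymxP Wu; apply/unitarymxP.
rewrite trmx_tens map_mxT tensmx_mul Vu Wu.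
apply/matrixP=> l l'; case: (mxtens_indexP l) => x y; case: (mxtens_indexP l') => x' y'.
rewrite tensmxE !mxE -natrM mulnb -xpair_eqE.
by rewrite (can_eq (@mxtens_indexK m n)).
Qed.

Lemma tens_map_unitary a b c d (Phi Phic : 'M[C]_a -> 'M[C]_b) (Psi Psic : 'M[C]_c -> 'M[C]_d)
    (V : 'M_b) (W : 'M_d) :
  (forall A, Phic A = V *m Phi A *m V^t*) -> (forall A, Psic A = W *m Psi A *m W^t*) ->
  forall X, tens_map Phic Psic X = tensmx V W *m tens_map Phi Psi X *m (tensmx V W)^t*.
Proof.
move=> PhiE PsiE X; rewrite /tens_map.
do 4![rewrite mulmx_sumr mulmx_suml; apply: eq_bigr => ? _].
by rewrite -scalemxAr -scalemxAl PhiE PsiE -!tensmx_mul trmx_tens map_mxT.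
Qed.

Lemma tens_pow_unitary a b (Phi Phic : 'M[C]_a -> 'M[C]_b) (V : 'M_b) :
  V \is unitarymx -> (forall A, Phic A = V *m Phi A *m V^t*) -> forall m,
  exists2 W : 'M_(powdim b m), W \is unitarymx &
    forall X, tens_pow Phic m X = W *m tens_pow Phi m X *m W^t*.
Proof.
move=> Vu PhiE; elim=> [|m [W Wu WE]] /=.
  have u1 : (1%:M : 'M[C]_1) \is unitarymx by apply/unitarymxP; rewrite mul1mx trmx1 map_mx1.
  by exists 1%:M => // X; rewrite mul1mx trmx1 map_mx1 mulmx1.
exists (tensmx V W); first exact: tensmx_unitary.
exact: tens_map_unitary.
Qed.

(** The adjoint swaps the two indices of each matrix unit, which exchanging the sums undoes. Outputs
    on Hermitian inputs are thus Hermitian, as unitary invariance of the entropy requires. *)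
Lemma tens_map_hermitian a b c d (Phi : 'M[C]_a -> 'M[C]_b) (Psi : 'M[C]_c -> 'M[C]_d) :
  (forall A, (Phi A)^t* = Phi (A^t*)) -> (forall A, (Psi A)^t* = Psi (A^t*)) ->
  forall X, (tens_map Phi Psi X)^t* = tens_map Phi Psi (X^t*).
Proof.
move=> PhiE PsiE X; rewrite /tens_map.
have trC_sum n (F : 'I_n -> 'M[C]_(b * d)) : (\sum_i F i)^t* = \sum_i (F i)^t*.
  by rewrite !raddf_sum.
rewrite exchange_big /= trC_sum; apply: eq_bigr => i _.
rewrite trC_sum; apply: eq_bigr => j _.
rewrite exchange_big /= trC_sum; apply: eq_bigr => k _.
rewrite trC_sum; apply: eq_bigr => l _.
rewrite linearZ map_mxZ /= trmx_tens map_mxT PhiE PsiE !mxE.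
by rewrite !trmx_delta !map_delta_mx.
Qed.

Lemma tens_pow_hermitian a b (Phi : 'M[C]_a -> 'M[C]_b) :
  (forall A, (Phi A)^t* = Phi (A^t*)) ->
  forall m X, (tens_pow Phi m X)^t* = tens_pow Phi m (X^t*).
Proof. by move=> PhiE; elim=> [|m IHm] //=; apply: tens_map_hermitian. Qed.

(** On every tensor power the two outputs are unitarily equivalent, so each coherent information is
    0 and so is each maximum. *)
Lemma quantum_capacity_self_complementary a b (Phi Phic : 'M[C]_a -> 'M[C]_b) (V : 'M_b) :
  (0 < a)%N -> V \is unitarymx -> (forall A, (Phi A)^t* = Phi (A^t*)) ->
  (forall A, Phic A = V *m Phi A *m V^t*) -> is_quantum_capacity Phi Phic 0.
Proof.
move=> a_gt0 Vu hPhi PhiE; exists (fun=> 0); split; last first.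
  by under eq_fun do rewrite mul0r; exact: cvg_cst.
move=> m _.
have Ic0 (rho : 'M_(powdim a m)) : density rho ->
    coherent_info (tens_pow Phi m) (tens_pow Phic m) rho = 0.
  move=> [[hrho _] _]; have [W Wu WE] := tens_pow_unitary Vu PhiE m.
  by rewrite /coherent_info WE vonNeumann_unitary ?subrr // tens_pow_hermitian // hrho.
split=> [|_ [rho drho <-]]; last by rewrite Ic0.
(* The maximum 0 has to be attained, which needs some input state: a basis state in positive
   dimension. *)
have k_gt0 : (0 < powdim a m)%N by elim: m {Ic0} => //= m IHm; rewrite muln_gt0 a_gt0.
exists (delta_mx (Ordinal k_gt0) (Ordinal k_gt0)); first exact: density_delta.
by rewrite Ic0 //; exact: density_delta.
Qed.

(** * The convolution in label coordinates *)

Lemma ketbraE (i j : 'Z_3) : ketbra i j = delta_mx i j :> 'M[C]_3.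
Proof. by rewrite /ketbra /ket trmx_delta map_delta_mx mul_delta_mx. Qed.

Lemma conv_labelE (i j : 'Z_3) : conv_label G_H (i, j) = (- i - j, j - i).
Proof.
(* The determinant is -2, which is 1 modulo 3. *)
rewrite /conv_label; have -> : \det G_H = 1.
  rewrite (expand_det_row _ 0) !big_ord_recl big_ord0 /cofactor !det_mx11 !mxE /=.
  exact: val_inj.
rewrite !mxE /=.
by case: i => [[|[|[|]]] //]; case: j => [[|[|[|]]] //] *; congr pair; apply: val_inj.
Qed.

(** Inverts the label permutation: for [a = - i - j] and [b = j - i], the sum is [-2 i = i] and the
    difference [-2 j = j] modulo 3. *)
Lemma conv_labelK (i j a b : 'Z_3) :
  (conv_label G_H (i, j) == (a, b)) = ((i, j) == (a + b, a - b)).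
Proof.
rewrite conv_labelE; apply/eqP/eqP => [[<- <-]|[-> ->]].
  by case: i => [[|[|[|]]] //]; case: j => [[|[|[|]]] //] *; congr pair; apply: val_inj.
by case: a => [[|[|[|]]] //]; case: b => [[|[|[|]]] //] *; congr pair; apply: val_inj.
Qed.

Lemma conv_unitaryE (a b i j : 'Z_3) :
  conv_unitary G_H (mxtens_index (a, b)) (mxtens_index (i, j)) =
  ((i, j) == (a + b, a - b))%:R :> C.
Proof.
rewrite -conv_labelK /conv_unitary; move: (conv_label G_H) => L.
rewrite pair_big summxE (bigD1 (i, j)) //= big1 ?addr0 => [|[i' j'] /= ne].
  rewrite tensmxE !ketbraE !mxE !eqxx !andbT -natrM mulnb.
  by rewrite -xpair_eqE -surjective_pairing eq_sym.
rewrite tensmxE !ketbraE !mxE -natrM mulnb andbACA.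
by rewrite -[(i == _) && _]xpair_eqE [(i, j) == _]eq_sym (negbTE ne) andbF.
Qed.

Lemma mul_conv_unitary n (X : 'M[C]_(3 * 3, n)) (a b : 'Z_3) k :
  (conv_unitary G_H *m X) (mxtens_index (a, b)) k =
  X (mxtens_index (a + b, a - b)) k.
Proof.
rewrite mxE (bigD1 (mxtens_index (a + b, a - b))) //= conv_unitaryE eqxx mul1r.
rewrite big1 ?addr0 // => l; case: (mxtens_indexP l) => i j ne.
rewrite conv_unitaryE; case: eqP => [ij|]; last by rewrite mul0r.
by move: ne; rewrite ij eqxx.
Qed.

Lemma conv_unitary_conj (X : 'M[C]_(3 * 3)) (a b a' b' : 'Z_3) :
  (conv_unitary G_H *m X *m (conv_unitary G_H)^t*)
    (mxtens_index (a, b)) (mxtens_index (a', b')) =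
  X (mxtens_index (a + b, a - b)) (mxtens_index (a' + b', a' - b')).
Proof.
(* Taking an adjoint turns the right factor into a left one, so the row rule applies a second
   time. *)
rewrite -mulmxA mul_conv_unitary -[X in LHS]trmxCK -trmxC_mul.
by rewrite 2!mxE mul_conv_unitary !mxE conjCK.
Qed.

Lemma conv_channelE (s rho : 'M[C]_3) (a a' : 'Z_3) :
  conv_channel G_H s rho a a' =
  \sum_(b : 'Z_3) rho (a + b) (a' + b) * s (a - b) (a' - b).
Proof. by rewrite mxE; apply: eq_bigr => b _; rewrite conv_unitary_conj tensmxE. Qed.

Lemma conv_channel_complE (s rho : 'M[C]_3) (b b' : 'Z_3) :
  conv_channel_compl G_H s rho b b' =
  \sum_(a : 'Z_3) rho (a + b) (a + b') * s (a - b) (a - b').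
Proof. by rewrite mxE; apply: eq_bigr => a _; rewrite conv_unitary_conj tensmxE. Qed.

(** Extensionality with indices typed as ring elements, so that label arithmetic is available. *)
Lemma mxZ3P (A B : 'M[C]_3) : (forall i j : 'Z_3, A i j = B i j) -> A = B.
Proof. by move=> AB; apply/matrixP => i j; apply: AB. Qed.

Lemma label_opE (f : 'Z_3 -> 'Z_3) (i j : 'Z_3) : label_op f i j = (i == f j)%:R :> C.
Proof.
rewrite summxE (bigD1 j) //= ketbraE mxE eqxx andbT big1 ?addr0 // => m mj.
by rewrite ketbraE mxE [j == m]eq_sym (negbTE mj) andbF.
Qed.

Lemma mul_label_op n (f : 'Z_3 -> 'Z_3) (A : 'M[C]_(3, n)) (i : 'Z_3) k :
  injective f -> (label_op f *m A) (f i) k = A i k.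
Proof.
move=> f_inj; rewrite mxE (bigD1 i) //= label_opE eqxx mul1r big1 ?addr0 // => j ji.
by rewrite label_opE (inj_eq f_inj) eq_sym (negbTE ji) mul0r.
Qed.

Lemma label_op_conj (f : 'Z_3 -> 'Z_3) (A : 'M[C]_3) (i j : 'Z_3) : injective f ->
  (label_op f *m A *m (label_op f)^t*) (f i) (f j) = A i j.
Proof.
move=> f_inj; rewrite -mulmxA mul_label_op // -[A in LHS]trmxCK -trmxC_mul.
by rewrite 2!mxE mul_label_op // !mxE conjCK.
Qed.

Lemma label_op_unitary (f : 'Z_3 -> 'Z_3) : injective f -> (label_op f : 'M[C]_3) \is unitarymx.
Proof.
move=> f_inj; rewrite -trmxC_unitary; apply/unitarymxP; rewrite trmxCK.
apply/matrixP=> i j; rewrite !mxE (bigD1 (f i)) //= !mxE !label_opE eqxx rmorph_nat mul1r.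
rewrite (inj_eq f_inj) big1 ?addr0 // => k ki.
by rewrite !mxE !label_opE (negbTE ki) rmorph0 mul0r.
Qed.

(** * The environment state and the symmetries of the channel *)

Definition psi_coef (p : R) (i : 'Z_3) : R :=
  if i == 0 then Num.sqrt p else if i == 1 then Num.sqrt (1 - p) else 0.

Lemma sigmaE (p : R) (i j : 'Z_3) : sigma p i j = (psi_coef p i * psi_coef p j)%:C.
Proof.
have psiE k : psi p k 0 = (psi_coef p k)%:C.
  rewrite !mxE !andbT /psi_coef.
  by case: k => [[|[|[|]]] //] k_lt; rewrite /= ?mulr1 ?mulr0 ?addr0 ?add0r.
rewrite mxE big_ord1 psiE [X in _ * X]mxE [X in _ * Num.conj X]mxE psiE.
by rewrite [Num.conj _]conjc_real -rmorphM.
Qed.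

(** The reflection exchanges 0 and 1 and fixes 2, where the amplitude is zero. *)
Lemma psi_coef_flip (p : R) i : psi_coef (1 - p) i = psi_coef p (1 - i).
Proof. by rewrite /psi_coef subKr; case: i => [[|[|[|]]] //]. Qed.

Lemma sigma_flip (p : R) (i j : 'Z_3) : sigma (1 - p) i j = sigma p (1 - i) (1 - j).
Proof. by rewrite [LHS]sigmaE [RHS]sigmaE (psi_coef_flip p i) (psi_coef_flip p j). Qed.

Lemma sigma_hermitian (p : R) : (sigma p)^t* = sigma p.
Proof. by rewrite trmxC_mul trmxCK. Qed.

Lemma conv_channel_hermitian (s rho : 'M[C]_3) : s^t* = s ->
  (conv_channel G_H s rho)^t* = conv_channel G_H s (rho^t*).
Proof.
move=> hs; apply: mxZ3P => a a'; rewrite 2!mxE.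
rewrite [RHS]conv_channelE (conv_channelE s rho) rmorph_sum.
apply: eq_bigr => b _; rewrite rmorphM.
by congr (_ * _); [rewrite !mxE | rewrite -[in RHS]hs !mxE].
Qed.

(** Exchanging the roles of [a] and [b] in the coordinate formula preserves [a + b] and negates
    [a - b]. Shifts by 1 turn this negation into the reflection that replaces [p] by [1 - p]. *)
Lemma Lambdac_flip (p : R) (rho : 'M[C]_3) :
  Lambdac p rho = Xop *m Lambda (1 - p) rho *m Xop^t*.
Proof.
apply: mxZ3P => b b'.
rewrite -[b](subrK 1) -[b'](subrK 1) (label_op_conj _ _ _ (@addIr 'Z_3 1)).
move: (b - 1) (b' - 1) => {b b'}b b'.
rewrite conv_channelE conv_channel_complE [RHS](reindex_inj (@addIr 'Z_3 1)) /=.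
apply: eq_bigr => a _; rewrite [in RHS]sigma_flip.
have e1 (x : 'Z_3) : a + (x + 1) = x + (a + 1) by rewrite addrCA.
(* The two sides differ by 3, hence agree in ['Z_3]. *)
have e2 (x : 'Z_3) : a - (x + 1) = 1 - (x - (a + 1)).
  by move: a x {e1}; do 2!case=> [[|[|[|]]] //] ?; apply: val_inj.
by rewrite !e1 !e2.
Qed.

(** Reflecting [a] and negating the summation index [b] reflects both [a + b] and [a - b]; the first
    is absorbed by the input, the second by the environment. *)
Lemma Lambda_reflect (p : R) (rho : 'M[C]_3) :
  Lambda p (Rop *m rho *m Rop^t*) = Rop *m Lambda (1 - p) rho *m Rop^t*.
Proof.
have f_inj : injective (fun j : 'Z_3 => 1 - j) by move=> i j /addrI /oppr_inj.
apply: mxZ3P => a a'; rewrite -[a](subKr 1) -[a'](subKr 1) (label_op_conj _ _ _ f_inj).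
move: (1 - a) (1 - a') => {a a'}a a'.
rewrite [LHS]conv_channelE [RHS]conv_channelE [LHS](reindex_inj (@oppr_inj 'Z_3)) /=.
apply: eq_bigr => b _; rewrite [in RHS]sigma_flip.
have e1 (x : 'Z_3) : 1 - x - b = 1 - (x + b) by rewrite opprD addrA.
have e2 (x : 'Z_3) : 1 - x - - b = 1 - (x - b) by rewrite opprB addrA addrAC opprK.
by rewrite !e1 !e2 (label_op_conj _ _ _ f_inj).
Qed.

(** The environment forces [a = a' = b + k], so the input label [j = a + b] is measured and
    [a = - j - k] is prepared. *)
Lemma conv_channel_ketbra (k : 'Z_3) (A : 'M[C]_3) :
  conv_channel G_H (ketbra k k) A = \sum_(j : 'Z_3) A j j *: ketbra (- j - k) (- j - k).
Proof.
apply: mxZ3P => a a'; rewrite conv_channelE summxE.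
rewrite [RHS](reindex_inj (@addrI _ a)) /=; apply: eq_bigr => b _.
rewrite [RHS]mxE !ketbraE !mxE.
have -> : (a == - (a + b) - k) && (a' == - (a + b) - k) = (a - b == k) && (a' - b == k).
  by move: a a' b k; do 4!case=> [[|[|[|]]] //] ?.
case: eqP => [e|_]; last by rewrite !mulr0.
by case: eqP => [|_]; [rewrite -e => /addIr -> | rewrite !mulr0].
Qed.

(** Input label [j] yields the outputs [- j - k] and [k - j], and modulo 3 the second is the first
    minus [k]. *)
Lemma conv_channel_compl_ketbra (k : 'Z_3) (A : 'M[C]_3) :
  conv_channel_compl G_H (ketbra k k) A =
  label_op (fun j => j - k) *m conv_channel G_H (ketbra k k) A
    *m (label_op (fun j => j - k))^t*.
Proof.
apply: mxZ3P => b b'; rewrite -[b](subrK (- k)) -[b'](subrK (- k)).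
rewrite (label_op_conj _ _ _ (addIr _)) opprK; move: (b + k) (b' + k) => {}b {}b'.
rewrite conv_channelE conv_channel_complE [RHS](reindex_inj (addIr (- k))) /=.
apply: eq_bigr => a _; rewrite !ketbraE !mxE.
have e1 (x : 'Z_3) : a + (x - k) = x + (a - k) by rewrite addrCA.
have e2 (x : 'Z_3) : (a - (x - k) == k) = (x - (a - k) == k).
  by move: a x k {e1 b b'}; do 3!case=> [[|[|[|]]] //] ?.
by rewrite !e1 !e2.
Qed.

Lemma sigma0 : sigma 0 = ketbra 1 1 :> 'M[C]_3.
Proof.
apply: mxZ3P => i j; rewrite sigmaE ketbraE mxE /psi_coef sqrtr0 subr0 sqrtr1.
by move: i j; do 2!case=> [[|[|[|]]] //] ?; rewrite /= ?mulr0 ?mul0r ?mulr1.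
Qed.

Lemma sigma1 : sigma 1 = ketbra 0 0 :> 'M[C]_3.
Proof.
apply: mxZ3P => i j; rewrite sigmaE ketbraE mxE /psi_coef subrr sqrtr0 sqrtr1.
by move: i j; do 2!case=> [[|[|[|]]] //] ?; rewrite /= ?mulr0 ?mul0r ?mulr1.
Qed.

(** * The output spectrum on [rho0] *)

Definition rho0_coef (i j : 'Z_3) : R :=
  if (i == 0) && (j == 0) then 3 / 4 else if (i == 2%R) || (j == 2%R) then 0 else 1 / 4.

Lemma rho0E (i j : 'Z_3) : rho0 i j = (rho0_coef i j)%:C :> C.
Proof.
have q n m : (n%:R / m%:R : C) = (n%:R / m%:R : R)%:C by rewrite fmorph_div !rmorph_nat.
have e1 : (3 / 4 : C) = (3 / 4 : R)%:C := q 3%N 4%N.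
have e2 : (1 / 4 : C) = (1 / 4 : R)%:C := q 1%N 4%N.
rewrite /rho0 e1 e2 !ketbraE !mxE /rho0_coef.
by move: i j; do 2!case=> [[|[|[|]]] //] ?; rewrite /= ?mulr0 ?mulr1 ?addr0 ?add0r.
Qed.

(** Entries come from a function on [nat], so that the indices left by cofactor expansion reduce by
    computation. *)
Lemma det_mx33 (K : comNzRingType) (f : nat -> nat -> K) :
  \det (\matrix_(i < 3, j < 3) f i j) =
    f 0 0 * (f 1 1 * f 2 2 - f 1 2 * f 2 1)
    - f 0 1 * (f 1 0 * f 2 2 - f 1 2 * f 2 0)
    + f 0 2 * (f 1 0 * f 2 1 - f 1 1 * f 2 0).
Proof.
rewrite (expand_det_row _ 0) !big_ord_recl big_ord0 /cofactor !(expand_det_row _ 0).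
rewrite !big_ord_recl !big_ord0 /cofactor !det_mx11 !mxE /= /bump /=.
ring.
Qed.

Lemma char_poly_block33 (K : comNzRingType) (a b c s : K) (f : nat -> nat -> K) :
  f 0 0 = a -> f 1 1 = b -> f 2 2 = c -> f 0 1 = s -> f 1 0 = s ->
  f 0 2 = 0 -> f 2 0 = 0 -> f 1 2 = 0 -> f 2 1 = 0 ->
  char_poly (\matrix_(i < 3, j < 3) f i j) =
  ('X - c%:P) * (('X - a%:P) * ('X - b%:P) - s%:P ^+ 2).
Proof.
move=> f00 f11 f22 f01 f10 f02 f20 f12 f21; rewrite /char_poly.
have -> : char_poly_mx (\matrix_(i < 3, j < 3) f i j) =
    \matrix_(i < 3, j < 3) ('X *+ (nat_of_ord i == j) - (f i j)%:P).
  by apply/matrixP=> i j; rewrite !mxE.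
rewrite (@det_mx33 _ (fun i j => 'X *+ (i == j) - (f i j)%:P)) /=.
rewrite f00 f11 f22 f01 f10 f02 f20 f12 f21 !mulr1n !mulr0n polyC0; ring.
Qed.

Definition Lambda_rho0_coef (p : R) (i j : nat) : R :=
  let s := Num.sqrt (p * (1 - p)) / 4 in
  nth 0 (nth [::] [:: [:: 3 * p / 4; s; 0]; [:: s; (1 - p) / 4; 0];
                      [:: 0; 0; (3 - 2 * p) / 4]] i) j.

Lemma Lambda_rho0 (p : R) : 0 <= p <= 1 ->
  Lambda p rho0 =
  map_mx (real_complex R) (\matrix_(i < 3, j < 3) Lambda_rho0_coef p i j).
Proof.
move=> /andP[p0 p1]; rewrite /Lambda_rho0_coef sqrtrM // -subr_ge0 in p1 *.
have sp := sqr_sqrtr p0; have sq := sqr_sqrtr p1.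
apply: mxZ3P => i j; rewrite conv_channelE !mxE.
under eq_bigr => b _ do rewrite !rho0E !sigmaE -rmorphM.
rewrite -rmorph_sum; congr (_%:C).
rewrite !big_ord_recl big_ord0.
move: i j; do 2!case=> [[|[|[|]]] //] ?; rewrite /rho0_coef /psi_coef /=.
all: by field: sp sq.
Qed.

Lemma rho0_hermitian : rho0^t* = rho0 :> 'M[C]_3.
Proof.
apply: mxZ3P => i j; rewrite 2!mxE !rho0E [Num.conj _]conjc_real.
by congr (_%:C); rewrite /rho0_coef andbC orbC.
Qed.

Lemma Lambda_hermitian (p : R) rho : (Lambda p rho)^t* = Lambda p (rho^t*).
Proof. exact/conv_channel_hermitian/sigma_hermitian. Qed.

(** The output splits into the entry [lam0 p] at label 2 and a two-dimensional block whose trace and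
    determinant are the sum and the product of [lamp p] and [lamm p]. *)
Lemma vonNeumann_Lambda_rho0 (p : R) : 0 <= p <= 1 ->
  vonNeumann (Lambda p rho0) = shannon (lam p).
Proof.
move=> p01; apply: vonNeumann_shannon; first by rewrite Lambda_hermitian rho0_hermitian.
(* The output matrix is real, so the polynomials are compared over [R]. *)
have -> : \prod_(i < 3) ('X - ((lam p 0 i)%:C)%:P) =
    map_poly (real_complex R) (\prod_(i < 3) ('X - (lam p 0 i)%:P)).
  by rewrite rmorph_prod; apply: eq_bigr => i _; rewrite rmorphB /= map_polyX map_polyC.
rewrite Lambda_rho0 // -map_char_poly; congr map_poly.
rewrite (@char_poly_block33 _ (3 * p / 4) ((1 - p) / 4) ((3 - 2 * p) / 4)
  (Num.sqrt (p * (1 - p)) / 4) (Lambda_rho0_coef p)) //.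
rewrite !big_ord_recl big_ord0 !mxE /= mulr1; congr (_ * _).
have /andP[p0 p1] := p01.
have sqE : Num.sqrt (p * (1 - p)) ^+ 2 = p * (1 - p).
  by rewrite sqr_sqrtr // mulr_ge0 // subr_ge0.
have dE : Num.sqrt (12 * p ^+ 2 - 4 * p + 1) ^+ 2 = 12 * p ^+ 2 - 4 * p + 1.
  by rewrite sqr_sqrtr //; nra.
have h1 : (3 * p / 4)%:P + ((1 - p) / 4)%:P = (lamp p)%:P + (lamm p)%:P.
  by rewrite -!rmorphD; congr (_%:P); rewrite /lamp /lamm; field.
have h2 : (3 * p / 4)%:P * ((1 - p) / 4)%:P - (Num.sqrt (p * (1 - p)) / 4)%:P ^+ 2 =
    (lamp p)%:P * (lamm p)%:P.
  rewrite -rmorphXn -!rmorphM -rmorphB; congr (_%:P); rewrite /lamp /lamm.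
  by field: sqE dE.
have -> : ('X - (lamp p)%:P) * ('X - (lamm p)%:P) =
  'X ^+ 2 - 'X * ((lamp p)%:P + (lamm p)%:P) + (lamp p)%:P * (lamm p)%:P by ring.
by rewrite -h1 -h2; ring.
Qed.

(** * Coherent informations and their signs *)

Lemma Xop_unitary : Xop \is @unitarymx C 3 3.
Proof. exact/label_op_unitary/addIr. Qed.

Lemma Rop_unitary : Rop \is @unitarymx C 3 3.
Proof. by apply/label_op_unitary => i j /addrI /oppr_inj. Qed.

Lemma vonNeumann_Lambdac (p : R) (rho : 'M[C]_3) : rho^t* = rho ->
  vonNeumann (Lambdac p rho) = vonNeumann (Lambda (1 - p) rho).
Proof.
by move=> hrho; rewrite Lambdac_flip vonNeumann_unitary ?Xop_unitary // Lambda_hermitian hrho.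
Qed.

Lemma rho1_hermitian : rho1^t* = rho1 :> 'M[C]_3.
Proof. by rewrite /rho1 !trmxC_mul trmxCK rho0_hermitian mulmxA. Qed.

Lemma vonNeumann_Lambda_rho1 (p : R) :
  vonNeumann (Lambda p rho1) = vonNeumann (Lambda (1 - p) rho0).
Proof.
by rewrite Lambda_reflect vonNeumann_unitary ?Rop_unitary // Lambda_hermitian rho0_hermitian.
Qed.

Lemma Ic0E (p : R) : 0 <= p <= 1 -> Ic0 p = shannon (lam p) - shannon (lam (1 - p)).
Proof.
move=> p01; congr (_ - _); first exact: vonNeumann_Lambda_rho0.
by rewrite [LHS]vonNeumann_Lambdac ?rho0_hermitian // [LHS]vonNeumann_Lambda_rho0 //; lra.
Qed.

(** Both reflecting the input and passing to the complementary channel replace [p] by [1 - p] in the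
    entropy, so reflection exchanges the two output entropies. *)
Lemma Ic1E (p : R) : Ic1 p = - Ic0 p.
Proof.
have e1 : vonNeumann (Lambda p rho1) = vonNeumann (Lambdac p rho0).
  by rewrite [LHS]vonNeumann_Lambda_rho1 [RHS]vonNeumann_Lambdac ?rho0_hermitian.
have e2 : vonNeumann (Lambdac p rho1) = vonNeumann (Lambda p rho0).
  rewrite [LHS](vonNeumann_Lambdac p rho1_hermitian).
  by rewrite [LHS]vonNeumann_Lambda_rho1 (subKr 1 p).
exact: etrans (congr2 (fun x y => x - y) e1 e2) (esym (opprB _ _)).
Qed.

(** The two vectors are (3/4, 1/4, 0) and (1/4, 3/4, 0). *)
Lemma shannon_lam01 : shannon (lam (0 : R)) = shannon (lam 1).
Proof.
rewrite /shannon !big_ord_recl !big_ord0 !mxE /= /lam0 /lamp /lamm.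
have -> : 12 * 0 ^+ 2 - 4 * 0 + 1 = 1 :> R by ring.
have -> : 12 * 1 ^+ 2 - 4 * 1 + 1 = 3 ^+ 2 :> R by ring.
rewrite sqrtr1 sqrtr_sqr ger0_norm //.
have -> : (3 - 2 * 0) / 4 = (1 + 2 * 1 + 3) / 8 :> R by field.
have -> : (1 + 2 * 0 + 1) / 8 = (3 - 2 * 1) / 4 :> R by field.
have -> : (1 + 2 * 0 - 1) / 8 = (1 + 2 * 1 - 3) / 8 :> R by field.
ring.
Qed.

Lemma Ic0_gt0 (p : R) : 0 < p < 2^-1 -> 0 < Ic0 p.
Proof.
move=> /andP[p0 p1]; rewrite Ic0E ?subr_gt0 ?shannon_lam_lt //.
by apply/andP; split; lra.
Qed.

Lemma Ic0_lt0 (p : R) : 2^-1 < p < 1 -> Ic0 p < 0.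
Proof.
move=> /andP[p0 p1]; rewrite Ic0E ?subr_lt0; last by apply/andP; split; lra.
by rewrite -{1}[p](subKr 1) shannon_lam_lt //; lra.
Qed.

Lemma Ic_lbE (p : R) : Ic_lb p = `|Ic0 p|.
Proof. by rewrite /Ic_lb Ic1E maxrN. Qed.

End Quantum.

Theorem theorem16 (R : realType) :
  (forall p : R, 0 <= p <= 1 ->
     Ic0 p = shannon (lam p) - shannon (lam (1 - p)) /\ Ic1 p = - Ic0 p) /\
  ((forall p : R, 0 < p < 2^-1 -> 0 < Ic0 p) /\
   (forall p : R, p = 0 \/ p = 2^-1 \/ p = 1 -> Ic0 p = 0) /\
   (forall p : R, 2^-1 < p < 1 -> Ic0 p < 0)) /\
  ((forall p : R, 0 <= p <= 1 -> Ic_lb p = `|Ic0 p|) /\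
   (forall p : R, 0 < p < 1 -> p <> 2^-1 -> 0 < Ic_lb p)) /\
  ((forall rho : 'M[R[i]]_3,
      Lambdac 2^-1 rho = Xop *m Lambda 2^-1 rho *m Xop^t*) /\
   unitarily_self_complementary (Lambda (2^-1 : R)) (Lambdac (2^-1 : R)) /\
   is_quantum_capacity (Lambda (2^-1 : R)) (Lambdac (2^-1 : R)) 0) /\
  (forall p : R, p = 0 \/ p = 1 ->
     entanglement_breaking (Lambda p) /\
     is_quantum_capacity (Lambda p) (Lambdac p) 0).
Proof.
(* The fixed point of the flip of [p], where [Lambdac_flip] relates the channel to its own
   complement. *)
have half : 1 - 2^-1 = 2^-1 :> R by lra.
have Lhalf (rho : 'M[R[i]]_3) : Lambdac 2^-1 rho = Xop *m Lambda 2^-1 rho *m Xop^t*.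
  by rewrite Lambdac_flip half.
split; first by move=> p p01; rewrite -Ic1E -Ic0E.
split; first split; first exact: Ic0_gt0.
  split; last exact: Ic0_lt0.
  move=> _ [->|[->|->]]; rewrite Ic0E; try (by apply/andP; split; lra).
  - by rewrite subr0 shannon_lam01 subrr.
  - by rewrite half subrr.
  - by rewrite subrr shannon_lam01 subrr.
split; first split.
- by move=> p _; rewrite Ic_lbE.
- move=> p /andP[p0 p1] /eqP p2; rewrite Ic_lbE normr_gt0.
  case: ltgtP p2 => // p2 _.
    by rewrite gt_eqF // Ic0_gt0 // p0.
  by rewrite lt_eqF // Ic0_lt0 // p2.
split; first split=> //; first split.
- by exists Xop => //; exact: Xop_unitary.
- apply: quantum_capacity_self_complementary Lhalf => //; first exact: Xop_unitary.
  exact: Lambda_hermitian.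
move=> p p01.
(* At both endpoints the environment is a label state: label 1 for [p = 0] and label 0 for
   [p = 1]. *)
have [k sE] : exists k, sigma p = ketbra k k :> 'M[R[i]]_3.
  by case: p01 => ->; [exists 1; exact: sigma0 | exists 0; exact: sigma1].
split.
  apply: (@measure_prepare_entanglement_breaking _ _ _
    (fun j : 'Z_3 => ketbra (- j - k) (- j - k))).
    by move=> j; rewrite ketbraE; exact: density_delta.
  by move=> A; rewrite /Lambda sE conv_channel_ketbra.
apply: (@quantum_capacity_self_complementary _ _ _ _ _ (label_op (fun j => j - k))) => //.
- exact/label_op_unitary/addIr.
- exact: Lambda_hermitian.
- by move=> A; rewrite /Lambda /Lambdac sE conv_channel_compl_ketbra.
Qed.
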